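(* Let $\Delta_{\mathrm{aff}}$ be an extended Dynkin diagram of type $\widetilde{A}_n$ ($n\ge1$), $\widetilde{D}_n$ ($n\geq 4$), $\widetilde{E}_6$, $\widetilde{E}_7$ or $\widetilde{E}_8$, with vertex set $(\Delta_{\mathrm{aff}})_0$ and extended vertex $0$. Let $I\subseteq(\Delta_{\mathrm{aff}})_0$ be a subset containing $0$. Then for all $i,j\in I$, $r_{i,j}=r_{j,i}$; that is, in the quiver of $\Gamma_I=e_I\Pi e_I$ the number of arrows from $i$ to $j$ equals the number of arrows from $j$ to $i$.
   Context: $\Pi$ is the preprojective algebra over $\mathbb{C}$ of $\Delta_{\mathrm{aff}}$: the path algebra of the double $\overline{Q}$ of any orientation $Q$ of $\Delta_{\mathrm{aff}}$, modulo the relation $\sum_{c\in Q_1}(cc^*-c^*c)=0$, graded by path length; $e_i$ is the trivial path at vertex $i$ and paths are composed left to right. For $I\subseteq(\Delta_{\mathrm{aff}})_0$ put $e_I=\sum_{i\in I}e_i$ and $\Gamma_I=e_I\Pi e_I$. Equivalently, $\Gamma_I\cong\mathrm{End}_R(\bigoplus_{i\in I}V_i)$, where $R=\mathbb{C}[U,V]^G$ is the corresponding Kleinian singularity and $V_i$ are the indecomposable Cohen–Macaulay $R$-modules corresponding to the vertices under the McKay correspondence ($V_0\cong R$). The algebra $\Gamma_I$ is non-negatively graded with degree zero part $\bigoplus_{i\in I}\mathbb{C}e_i$; writing $J$ for its positive degree part, the quiver of $\Gamma_I$ has vertex set $I$ and the number of arrows from $i$ to $j$ is $r_{i,j}=\dim_{\mathbb{C}}e_i(J/J^2)e_j$.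 *)

(* Defs.v *)
From HB Require Import structures.
From mathcomp Require Import all_boot all_order all_algebra.
From mathcomp Require Import generic_quotient ring_quotient finmap monalg.
From mathcomp Require Import boolp classical_sets.

Set Implicit Arguments.
Unset Strict Implicit.
Unset Printing Implicit Defensive.

Import GRing.Theory.
Local Open Scope classical_set_scope.
Local Open Scope ring_scope.
Local Open Scope quotient_scope.

Section LinearAlgebra.
Variables (F : fieldType) (V : lmodType F).
Implicit Types W S : set V.

Definition lspan W : set V :=
  [set x | exists (n : nat) (c : 'I_n -> F) (w : 'I_n -> V),
     (forall k, W (w k)) /\ x = \sum_k c k *: w k].

Lemma lspan0 W : lspan W 0.
Proof.
by exists 0%N, (fun=> 0), (fun=> 0); split=> [[]//|]; rewrite big_ord0.
Qed.

Lemma lspanZ W a x : lspan W x -> lspan W (a *: x).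
Proof.
move=> [n [c [w [Ww ->]]]]; exists n, (fun k => a * c k), w; split=> //.
by rewrite scaler_sumr; apply: eq_bigr => k _; rewrite scalerA.
Qed.

Lemma lspanD W x y : lspan W x -> lspan W y -> lspan W (x + y).
Proof.
move=> [n [c [w [Ww ->]]]] [m [d [z [Wz ->]]]].
exists (n + m)%N, (fun k => match split k with inl i => c i | inr j => d j end),
  (fun k => match split k with inl i => w i | inr j => z j end); split.
  by move=> k; case: (split k).
rewrite big_split_ord /=; congr (_ + _); apply: eq_bigr => k _.
  by have := unsplitK (inl k : 'I_n + 'I_m); rewrite /unsplit => ->.
by have := unsplitK (inr k : 'I_n + 'I_m); rewrite /unsplit => ->.
Qed.

Lemma sub_lspan W x : W x -> lspan W x.
Proof.
by move=> Wx; exists 1%N, (fun=> 1), (fun=> x); rewrite big_ord1 scale1r.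
Qed.

Definition has_dim S (n : nat) : Prop :=
  exists b : 'I_n -> V,
    [/\ forall k, S (b k),
        forall c : 'I_n -> F, \sum_k c k *: b k = 0 -> forall k, c k = 0
      & forall x, S x -> exists c : 'I_n -> F, x = \sum_k c k *: b k].

Lemma has_dim_le S m n : has_dim S m -> has_dim S n -> (m <= n)%N.
Proof.
move=> [b [Sb freeb _]] [d [Sd _ spand]].
have /choice[C bE] k : exists c : 'I_n -> F, b k = \sum_j c j *: d j.
  exact/spand/Sb.
pose M : 'M[F]_(m, n) := \matrix_(k, j) C k j.
suff: row_free M by rewrite /row_free => /eqP <-; exact: rank_leq_col.
apply/inj_row_free => v vM0; apply/rowP => k; rewrite mxE.
apply: (freeb (fun k => v 0 k)).
under eq_bigr => l _ do rewrite bE scaler_sumr.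
rewrite exchange_big big1 // => j _ /=.
under eq_bigr => l _ do rewrite scalerA.
rewrite -scaler_suml (_ : \sum_l _ = (v *m M) 0 j).
  by rewrite vM0 mxE scale0r.
by rewrite mxE; apply: eq_bigr => l _; rewrite mxE.
Qed.

(* The dimension of a linear subspace S; None stands for an infinite one. *)
Definition ldim S : option nat :=
  match pselect (exists n, has_dim S n) with
  | left ex_n => Some (projT1 (cid ex_n))
  | right _ => None
  end.

Lemma ldimP S n : ldim S = Some n <-> has_dim S n.
Proof.
rewrite /ldim; case: pselect => [ex_n|nex_n]; last first.
  by split=> // Sn; case: nex_n; exists n.
case: cid => m /= Sm; split=> [[<-]//|Sn]; congr Some.
by apply/eqP; rewrite eqn_leq (has_dim_le Sm Sn) (has_dim_le Sn Sm).
Qed.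

Definition lspan_pred W : {pred V} := [pred x | `[< lspan W x >]].

Lemma lspan_zmod_closed W : zmod_closed (lspan_pred W).
Proof.
split=> [|x y]; first by apply/asboolP; exact: lspan0.
move=> /asboolP Wx /asboolP Wy; apply/asboolP/lspanD => //.
by rewrite -scaleN1r; apply: lspanZ.
Qed.
HB.instance Definition _ W :=
  GRing.isZmodClosed.Build V (lspan_pred W) (lspan_zmod_closed W).

(* V / lspan W *)
Definition quotl W : Type := Quotient.quot (lspan_pred W).
HB.instance Definition _ W := GRing.Zmodule.on (quotl W).
HB.instance Definition _ W := Quotient.on (quotl W).

Definition piq W (x : V) : quotl W := \pi_(quotl W) x.

Lemma piq_eq W x y : piq W x = piq W y <-> lspan W (x - y).
Proof.
split=> [/eqP|/asboolP Wxy].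
  by rewrite /piq -[_ == _]Quotient.idealrBE => /asboolP.
by apply/eqP; rewrite /piq -[_ == _]Quotient.idealrBE.
Qed.

Lemma piq_surj W (u : quotl W) : exists x, u = piq W x.
Proof. by exists (repr u); rewrite /piq reprK. Qed.

Lemma piqD W : {morph piq W : x y / x + y}.
Proof. by move=> x y; exact: (Quotient.pi_add (lspan_pred W)). Qed.

Lemma piqN W : {morph piq W : x / - x}.
Proof. by move=> x; exact: (Quotient.pi_opp (lspan_pred W)). Qed.

Definition scaleq W (a : F) (u : quotl W) : quotl W := piq W (a *: repr u).

Lemma scaleq_piq W a x : scaleq a (piq W x) = piq W (a *: x).
Proof.
apply/piq_eq; rewrite -scalerBr; apply/lspanZ/piq_eq.
by rewrite /piq reprK.
Qed.

Lemma scaleqA W a b (u : quotl W) : scaleq a (scaleq b u) = scaleq (a * b) u.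
Proof. by have [x ->] := piq_surj u; rewrite !scaleq_piq scalerA. Qed.

Lemma scaleq1 W : left_id 1 (@scaleq W).
Proof. by move=> u; have [x ->] := piq_surj u; rewrite scaleq_piq scale1r. Qed.

Lemma scaleqDr W : right_distributive (@scaleq W) +%R.
Proof.
move=> a u v; have [x ->] := piq_surj u; have [y ->] := piq_surj v.
by rewrite -piqD !scaleq_piq scalerDr piqD.
Qed.

Lemma scaleqDl W (u : quotl W) : {morph (@scaleq W)^~ u : a b / a + b}.
Proof.
by move=> a b; have [x ->] := piq_surj u; rewrite !scaleq_piq scalerDl piqD.
Qed.

HB.instance Definition _ W := GRing.Zmodule_isLmodule.Build F (quotl W)
  (@scaleqA W) (@scaleq1 W) (@scaleqDr W) (@scaleqDl W).

Lemma piq_is_linear W : linear (piq W).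
Proof. by move=> a x y; rewrite piqD -scaleq_piq. Qed.
HB.instance Definition _ W :=
  GRing.isLinear.Build F V (quotl W) *:%R (piq W) (piq_is_linear W).

End LinearAlgebra.

Section FreeModule.
Variables (F : fieldType) (K : choiceType).
Implicit Types f g : {malg F[K]}.

(* The linear extension to {malg F[K]} of a map h defined on the basis K. *)
Definition malg_lin (W : lmodType F) (h : K -> W) f : W :=
  \sum_(k <- msupp f) f@_k *: h k.

Section Lin.
Variables (W : lmodType F) (h : K -> W).

Lemma malg_linEw f (D : {fset K}) : (msupp f `<=` D)%fset ->
  malg_lin h f = \sum_(k <- D) f@_k *: h k.
Proof.
move=> sfD; apply: big_fset_incl => // k _ /mcoeff_outdom ->.
by rewrite scale0r.
Qed.

Lemma malg_lin_is_linear : linear (malg_lin h).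
Proof.
move=> a f g; pose D := (msupp (a *: f + g) `|` (msupp f `|` msupp g))%fset.
rewrite (@malg_linEw _ D) ?fsubsetUl //.
rewrite (@malg_linEw f D); last first.
  by apply: fsubset_trans (fsubsetUr _ _); apply: fsubsetUl.
rewrite (@malg_linEw g D); last first.
  by apply: fsubset_trans (fsubsetUr _ _); apply: fsubsetUr.
rewrite scaler_sumr -big_split /=; apply: eq_bigr => k _.
by rewrite mcoeffD mcoeffZ scalerDl scalerA.
Qed.
HB.instance Definition _ :=
  GRing.isLinear.Build F {malg F[K]} W *:%R (malg_lin h) malg_lin_is_linear.

Lemma malg_linU k : malg_lin h << k >> = h k.
Proof.
by rewrite (malg_linEw msuppU_le) big_seq_fset1 mcoeffUU scale1r.
Qed.

Lemma malg_lin_comp (W' : lmodType F) (phi : {linear W -> W'}) f :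
  phi (malg_lin h f) = malg_lin (fun k => phi (h k)) f.
Proof. by rewrite linear_sum; apply: eq_bigr => k _; rewrite linearZ. Qed.

Lemma eq_malg_lin (h' : K -> W) : h =1 h' -> malg_lin h =1 malg_lin h'.
Proof. by move=> eqh f; apply: eq_bigr => k _; rewrite eqh. Qed.

Lemma malg_lin_add (h' : K -> W) f :
  malg_lin (fun k => h k + h' k) f = malg_lin h f + malg_lin h' f.
Proof. by rewrite -big_split; apply: eq_bigr => k _; rewrite scalerDr. Qed.

Lemma malg_lin_scale a f :
  malg_lin (fun k => a *: h k) f = a *: malg_lin h f.
Proof.
by rewrite scaler_sumr; apply: eq_bigr => k _; rewrite !scalerA mulrC.
Qed.
End Lin.

Lemma malg_lin_id f : malg_lin (fun k => << k >>) f = f.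
Proof.
rewrite [RHS]monalgE; apply: eq_bigr => k _; apply/malgP => k'.
by rewrite mcoeffZ !mcoeffU mulr_natr.
Qed.
End FreeModule.

Record quiver := Quiver {
  vtx : finType;
  arr : finType;
  asrc : arr -> vtx;
  atgt : arr -> vtx
}.

Section PathAlgebra.
Variables (F : fieldType) (Q : quiver).

Fixpoint is_path (x : vtx Q) (s : seq (arr Q)) : bool :=
  if s is a :: s' then (asrc a == x) && is_path (atgt a) s' else true.

(* A path is its source together with its arrows, listed from left to right;
   the source is needed to tell the trivial paths apart. *)
Definition qpath : Type := {p : vtx Q * seq (arr Q) | is_path p.1 p.2}.
HB.instance Definition _ := Choice.on qpath.
HB.instance Definition _ := SubType.on qpath.

Definition psrc (p : qpath) : vtx Q := (val p).1.
Definition parr (p : qpath) : seq (arr Q) := (val p).2.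
Definition ptgt (p : qpath) : vtx Q := last (psrc p) (map (@atgt Q) (parr p)).
Definition plen (p : qpath) : nat := size (parr p).

Definition triv_path (i : vtx Q) : qpath := exist _ (i, [::]) isT.

Lemma arr_path_subproof (a : arr Q) : is_path (asrc a) [:: a].
Proof. by rewrite /= eqxx. Qed.
Definition arr_path (a : arr Q) : qpath :=
  exist _ (asrc a, [:: a]) (arr_path_subproof a).

Lemma is_path_cat x s t :
  is_path x (s ++ t) = is_path x s && is_path (last x (map (@atgt Q) s)) t.
Proof. by elim: s x => //= a s IHs x; rewrite IHs andbA. Qed.

Lemma pcat_subproof (p q : qpath) :
  ptgt p = psrc q -> is_path (psrc p) (parr p ++ parr q).
Proof. by move=> pq; rewrite is_path_cat (valP p) -/(ptgt p) pq (valP q). Qed.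

(* The path "p, then q", if p ends where q starts. *)
Definition pcat (p q : qpath) : option qpath :=
  if ptgt p =P psrc q is ReflectT pq
  then Some (exist _ (psrc p, parr p ++ parr q) (pcat_subproof pq))
  else None.

Lemma pcatP (p q : qpath) : ptgt p = psrc q ->
  exists r, [/\ pcat p q = Some r, psrc r = psrc p, ptgt r = ptgt q
              & parr r = parr p ++ parr q].
Proof.
rewrite /pcat; case: eqP => // pq _; eexists; split=> //.
by rewrite /ptgt /parr /psrc /= map_cat last_cat -/(ptgt p) pq.
Qed.

Lemma pcatN (p q : qpath) : ptgt p <> psrc q -> pcat p q = None.
Proof. by rewrite /pcat; case: eqP. Qed.

Lemma qpathP (p q : qpath) : psrc p = psrc q -> parr p = parr q -> p = q.
Proof.
move=> e1 e2; apply: val_inj.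
by rewrite [LHS]surjective_pairing [RHS]surjective_pairing; congr (_, _).
Qed.

Definition path_alg : Type := {malg F[qpath]}.
HB.instance Definition _ := GRing.Lmodule.on path_alg.
Implicit Types f g : path_alg.

Definition pelt (p : qpath) : path_alg := << p >>.

Definition pmul_basis (p q : qpath) : path_alg :=
  if pcat p q is Some r then pelt r else 0.

Fact pmul_key : unit. Proof. by []. Qed.
(* Locked, to keep unification from unfolding products. *)
Definition pmul : path_alg -> path_alg -> path_alg :=
  locked_with pmul_key
    (fun f g => malg_lin (fun p => malg_lin (fun q => pmul_basis p q) g) f).

Lemma pmul_def f g :
  pmul f g = malg_lin (fun p => malg_lin (fun q => pmul_basis p q) g) f.
Proof. by rewrite /pmul locked_withE. Qed.

Definition pone : path_alg := \sum_(i : vtx Q) pelt (triv_path i).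

Lemma pmulDl : left_distributive pmul +%R.
Proof. by move=> f g k; rewrite !pmul_def linearD. Qed.

Lemma pmulDr : right_distributive pmul +%R.
Proof.
move=> f g k; rewrite !pmul_def -malg_lin_add.
by apply: eq_malg_lin => p; rewrite linearD.
Qed.

Lemma pmulZl a f g : a *: pmul f g = pmul (a *: f) g.
Proof. by rewrite !pmul_def linearZ. Qed.

Lemma pmulZr a f g : a *: pmul f g = pmul f (a *: g).
Proof.
rewrite !pmul_def -malg_lin_scale.
by apply: eq_malg_lin => p; rewrite linearZ.
Qed.

Lemma pmulE p q : pmul (pelt p) (pelt q) = pmul_basis p q.
Proof. by rewrite !pmul_def /pelt !malg_linU. Qed.

Lemma pmul_basisA p q r :
  pmul (pelt p) (pmul_basis q r) = pmul (pmul_basis p q) (pelt r).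
Proof.
have m0 f : pmul 0 f = 0 by rewrite !pmul_def linear0.
have m0' s : pmul (pelt s) 0 = 0 by rewrite !pmul_def malg_linU linear0.
rewrite /pmul_basis.
have [pq|npq] := eqVneq (ptgt p) (psrc q); last first.
  rewrite (@pcatN p q) ?m0; last exact/eqP.
  have [qr|nqr] := eqVneq (ptgt q) (psrc r); last first.
    by rewrite pcatN ?m0' //; exact/eqP.
  have [s [-> ss _ _]] := pcatP qr.
  by rewrite pmulE /pmul_basis pcatN // ss; exact/eqP.
have [t [-> ts tt ta]] := pcatP pq.
have [qr|nqr] := eqVneq (ptgt q) (psrc r); last first.
  rewrite pcatN ?m0'; last exact/eqP.
  by rewrite pmulE /pmul_basis pcatN // tt; exact/eqP.
have [s [-> ss st sa]] := pcatP qr.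
rewrite !pmulE /pmul_basis.
have [u [-> us _ ua]] : exists u, [/\ pcat p s = Some u, psrc u = psrc p,
    ptgt u = ptgt s & parr u = parr p ++ parr s] by apply: pcatP; rewrite ss.
have [v [-> vs _ va]] : exists v, [/\ pcat t r = Some v, psrc v = psrc t,
    ptgt v = ptgt r & parr v = parr t ++ parr r] by apply: pcatP; rewrite tt.
congr pelt; apply: qpathP; first by rewrite us vs ts.
by rewrite ua va sa ta catA.
Qed.

Lemma pmul_linl h f g :
  pmul (malg_lin h f) g = malg_lin (fun p => pmul (h p) g) f.
Proof.
by rewrite pmul_def malg_lin_comp; apply: eq_malg_lin => p; rewrite pmul_def.
Qed.

Lemma pmul_linr h f g :
  pmul f (malg_lin h g) = malg_lin (fun q => pmul f (h q)) g.
Proof.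
have pmulr0 : pmul f 0 = 0 
  by rewrite -[X in pmul f X](scale0r (0 : path_alg)) -pmulZr scale0r.
rewrite /malg_lin (big_morph (pmul f) (pmulDr f) pmulr0).
by apply: eq_bigr => q _; rewrite pmulZr.
Qed.

Lemma pmulA : associative pmul.
Proof.
move=> f g k.
rewrite -(malg_lin_id f) (pmul_linl _ f g) !(pmul_linl _ f).
apply: eq_malg_lin => p.
rewrite -(malg_lin_id g) (pmul_linl _ g k) !(pmul_linr _ _ g) (pmul_linl _ g k).
apply: eq_malg_lin => q.
rewrite -(malg_lin_id k) !(pmul_linr _ _ k); apply: eq_malg_lin => r.
by rewrite !pmulE pmul_basisA.
Qed.

Lemma pmul1 : left_id pone pmul.
Proof.
move=> f; rewrite pmul_def /pone linear_sum -[RHS]malg_lin_id.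
under eq_bigr => i _ do rewrite /= /pelt malg_linU.
rewrite exchange_big; apply: eq_bigr => q _ /=.
rewrite -scaler_sumr (bigD1 (psrc q)) //= big1 ?addr0 => [|i iq].
  rewrite /pmul_basis.
  have [r [-> rs _ ra]] := @pcatP (triv_path (psrc q)) q erefl.
  by congr (_ *: _); congr pelt; apply: qpathP.
by rewrite /pmul_basis pcatN //; exact/eqP.
Qed.

Lemma pmulr1 : right_id pone pmul.
Proof.
move=> f; rewrite -[RHS]malg_lin_id pmul_def; apply: eq_malg_lin => p.
rewrite /pone linear_sum; under eq_bigr => i _ do rewrite /= /pelt malg_linU.
rewrite (bigD1 (ptgt p)) //= big1 ?addr0 => [|i ip].
  rewrite /pmul_basis.
  have [r [-> rs _ ra]] := @pcatP p (triv_path (ptgt p)) erefl.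
  by congr pelt; apply: qpathP; rewrite // ra cats0.
by rewrite /pmul_basis pcatN // => /esym/eqP; rewrite (negPf ip).
Qed.

HB.instance Definition _ := GRing.Zmodule_isPzRing.Build path_alg
  pmulA pmul1 pmulr1 pmulDl pmulDr.

Lemma path_scalerAl a (x y : path_alg) : a *: (x * y) = (a *: x) * y.
Proof. exact: pmulZl. Qed.

Lemma path_scalerAr a (x y : path_alg) : a *: (x * y) = x * (a *: y).
Proof. exact: pmulZr. Qed.

End PathAlgebra.
Section Preprojective.
Variables (F : fieldType) (Q : quiver).

Definition double_quiver : quiver := {|
  vtx := vtx Q;
  arr := (arr Q + arr Q)%type;
  asrc := fun a => match a with inl c => asrc c | inr c => atgt c end;
  atgt := fun a => match a with inl c => atgt c | inr c => asrc c end
|}.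

Local Notation A := (path_alg F double_quiver).

Definition arr_elt (a : arr double_quiver) : A := pelt F (arr_path a).

Definition preproj_rel : A :=
  \sum_(c : arr Q) (arr_elt (inl c) * arr_elt (inr c)
                    - arr_elt (inr c) * arr_elt (inl c)).

(* Its linear span is the two-sided ideal generated by preproj_rel. *)
Definition preproj_gens : set A :=
  [set x | exists a b : A, x = a * preproj_rel * b].

Lemma preproj_idealMl (a x : A) :
  lspan preproj_gens x -> lspan preproj_gens (a * x).
Proof.
move=> [n [c [w [Ww ->]]]].
exists n, c, (fun k => a * w k); split=> [k|].
  by have [b [d ->]] := Ww k; exists (a * b), d; rewrite !mulrA.
by rewrite mulr_sumr; apply: eq_bigr => k _; rewrite -path_scalerAr.
Qed.

Lemma preproj_idealMr (x b : A) :
  lspan preproj_gens x -> lspan preproj_gens (x * b).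
Proof.
move=> [n [c [w [Ww ->]]]].
exists n, c, (fun k => w k * b); split=> [k|].
  by have [a [d ->]] := Ww k; exists a, (d * b); rewrite mulrA.
by rewrite mulr_suml; apply: eq_bigr => k _; rewrite -path_scalerAl.
Qed.

Definition preproj : Type := quotl preproj_gens.
HB.instance Definition _ := GRing.Lmodule.on preproj.

Definition pi_preproj (x : A) : preproj := piq preproj_gens x.

Definition ppmul : preproj -> preproj -> preproj :=
  lift_op2 (quotl preproj_gens) *%R.

Lemma ppmul_pi x y : ppmul (pi_preproj x) (pi_preproj y) = pi_preproj (x * y).
Proof.
have reprP z : lspan preproj_gens (repr (piq preproj_gens z) - z).
  by apply/piq_eq; rewrite /piq reprK.
unlock ppmul; apply/piq_eq.
set x' := repr (pi_preproj x); set y' := repr (pi_preproj y).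
have -> : x' * y' - x * y = x' * (y' - y) + (x' - x) * y.
  by rewrite mulrBr mulrBl addrA subrK.
apply: lspanD; first by apply: preproj_idealMl; exact: reprP.
by apply: preproj_idealMr; exact: reprP.
Qed.

Let pi_surj (u : preproj) : exists x, u = pi_preproj x.
Proof. exact: piq_surj. Qed.

Lemma ppmulA : associative ppmul.
Proof.
move=> u v w; have [x ->] := pi_surj u; have [y ->] := pi_surj v.
by have [z ->] := pi_surj w; rewrite !ppmul_pi mulrA.
Qed.

Lemma ppmul1 : left_id (pi_preproj 1) ppmul.
Proof. by move=> u; have [x ->] := pi_surj u; rewrite ppmul_pi mul1r. Qed.

Lemma ppmulr1 : right_id (pi_preproj 1) ppmul.
Proof. by move=> u; have [x ->] := pi_surj u; rewrite ppmul_pi mulr1. Qed.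

Lemma ppmulDl : left_distributive ppmul +%R.
Proof.
move=> u v w; have [x ->] := pi_surj u; have [y ->] := pi_surj v.
have [z ->] := pi_surj w.
by rewrite -[_ + _]piqD !ppmul_pi mulrDl -[RHS]piqD.
Qed.

Lemma ppmulDr : right_distributive ppmul +%R.
Proof.
move=> u v w; have [x ->] := pi_surj u; have [y ->] := pi_surj v.
have [z ->] := pi_surj w.
by rewrite -[_ + _]piqD !ppmul_pi mulrDr -[RHS]piqD.
Qed.

HB.instance Definition _ := GRing.Zmodule_isPzRing.Build preproj
  ppmulA ppmul1 ppmulr1 ppmulDl ppmulDr.

(* Degree d part of the grading by path length. *)
Definition preproj_deg (d : nat) : set preproj :=
  lspan [set pi_preproj (pelt F p) | p in [set p | plen p = d]].

Definition vtx_idem (i : vtx Q) : preproj :=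
  pi_preproj (pelt F (triv_path (i : vtx double_quiver))).

Definition set_idem (I : {set vtx Q}) : preproj := \sum_(i in I) vtx_idem i.

Definition corner_alg (I : {set vtx Q}) : set preproj :=
  [set set_idem I * x * set_idem I | x in setT].

(* The positive degree part J of e_I Pi e_I. *)
Definition corner_pos (I : {set vtx Q}) : set preproj :=
  lspan [set x | corner_alg I x /\ exists2 d, (0 < d)%N & preproj_deg d x].

Definition corner_pos2 (I : {set vtx Q}) : set preproj :=
  lspan [set x * y | x in corner_pos I & y in corner_pos I].

(* e_i (J / J^2) e_j, as a subspace of Pi / J^2. *)
Definition corner_arrows (I : {set vtx Q}) (i j : vtx Q) :
    set (quotl (corner_pos2 I)) :=
  [set piq (corner_pos2 I) (vtx_idem i * x * vtx_idem j) | x in corner_pos I].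

Definition arrow_count (I : {set vtx Q}) (i j : vtx Q) : option nat :=
  ldim (@corner_arrows I i j).

End Preprojective.

Record multigraph := Multigraph {
  mvtx : finType;
  medge : finType;
  mends : medge -> mvtx * mvtx
}.

Definition orientation (G : multigraph) : Type := medge G -> bool.

Definition orient (G : multigraph) (o : orientation G) : quiver := {|
  vtx := mvtx G;
  arr := medge G;
  asrc := fun e => if o e then (mends e).1 else (mends e).2;
  atgt := fun e => if o e then (mends e).2 else (mends e).1
|}.

Inductive affine_type : Type :=
  | AffA (n : nat) of (1 <= n)%N
  | AffD (n : nat) of (4 <= n)%N
  | AffE6
  | AffE7
  | AffE8.

Definition aff_rank (t : affine_type) : nat :=
  match t with
  | AffA n _ | AffD n _ => n
  | AffE6 => 6
  | AffE7 => 7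
  | AffE8 => 8
  end%N.

(* Bourbaki labelling, 0 being the extended vertex; the edge list of type
   A_1 is (0,1), (1,0), i.e. a double edge. *)
Definition aff_edges (t : affine_type) : seq (nat * nat) :=
  match t with
  | AffA n _ => rcons [seq (k, k.+1) | k <- iota 0 n] (n, 0)
  | AffD n _ =>
      [:: (0, 2), (n - 2, n) & [seq (k, k.+1) | k <- iota 1 (n - 2)]]
  | AffE6 => [:: (0, 2); (2, 4); (1, 3); (3, 4); (4, 5); (5, 6)]
  | AffE7 => [:: (0, 1); (2, 4); (1, 3); (3, 4); (4, 5); (5, 6); (6, 7)]
  | AffE8 =>
      [:: (0, 8); (2, 4); (1, 3); (3, 4); (4, 5); (5, 6); (6, 7); (7, 8)]
  end%N.

Lemma aff_edges_le t :
  all (fun e => (e.1 <= aff_rank t) && (e.2 <= aff_rank t))%N (aff_edges t).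
Proof.
case: t => [n ? | n n_ge4 | | |] //=.
  rewrite all_rcons /= leqnn /=; apply/allP => _ /mapP[k + ->] /=.
  by rewrite mem_iota add0n => /andP[_ kn]; rewrite kn ltnW.
rewrite leqnn leq_subr (leq_trans _ n_ge4) //=.
apply/allP => _ /mapP[k + ->] /=; rewrite mem_iota => /andP[_].
rewrite add1n ltnS => kn.
rewrite (leq_trans kn (leq_subr _ _)) (leq_ltn_trans kn) // ltn_subrL /=.
by apply: leq_trans n_ge4.
Qed.

(* The cast inord is harmless by aff_edges_le. *)
Definition aff_diagram (t : affine_type) : multigraph := {|
  mvtx := 'I_(aff_rank t).+1;
  medge := 'I_(size (aff_edges t));
  mends := fun e => let: (a, b) := nth (0, 0)%N (aff_edges t) e in
                    (inord a, inord b)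
|}.

(* Main.v *)
(** Reversing paths while exchanging [c] and [c^*] is an involutive
    anti-automorphism of the path algebra of the double quiver. It fixes
    [c c^*] and [c^* c], hence the preprojective relation, so it descends to
    [Pi]. There it fixes every [e_i] and preserves the grading, hence also
    [e_I Pi e_I], [J] and [J^2]; thus it induces a linear bijection from
    [e_i (J / J^2) e_j] onto [e_j (J / J^2) e_i]. *)

From HB Require Import structures.
Require Import Defs.
From mathcomp Require Import all_boot all_order all_algebra reals complex.
From mathcomp Require Import monalg boolp classical_sets.

Set Implicit Arguments.
Unset Strict Implicit.
Unset Printing Implicit Defensive.

Import GRing.Theory.
Local Open Scope classical_set_scope.
Local Open Scope ring_scope.

(** * Linear maps, dimension and quotient spaces *)

Section LinearMaps.
Variables (F : fieldType) (V V' : lmodType F).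

Lemma lspan_image (f : {linear V -> V'}) (W : set V) (W' : set V') :
  (forall x, W x -> lspan W' (f x)) -> forall x, lspan W x -> lspan W' (f x).
Proof.
move=> fW _ [n [c [w [Ww ->]]]]; rewrite linear_sum.
elim/big_ind: _ => [|y z|k _]; first exact: lspan0.
  exact: lspanD.
by rewrite linearZ; apply/lspanZ/fW.
Qed.

Lemma has_dim_image (f : {linear V -> V'}) (S : set V) n :
  injective f -> has_dim S n -> has_dim (f @` S) n.
Proof.
move=> f_inj [b [Sb freeb spanb]]; exists (f \o b); split=> [k|c|_ [x Sx <-]].
- by exists (b k).
- move=> fc0; apply: freeb; apply: f_inj; rewrite linear0 linear_sum -[RHS]fc0.
  by apply: eq_bigr => k _; rewrite linearZ.
- have [c ->] := spanb x Sx; exists c; rewrite linear_sum.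
  by apply: eq_bigr => k _; rewrite linearZ.
Qed.

(** Comparing all [n] at once also settles infinite dimension: if no [n] fits either side, both
    values are [None]. *)
Lemma eq_ldim (S : set V) (S' : set V') :
  (forall n, has_dim S n <-> has_dim S' n) -> ldim S = ldim S'.
Proof.
move=> SS'; case E: (ldim S) => [n|].
  by apply/esym/ldimP/SS'/ldimP.
case E': (ldim S') => [n|] //.
by move/ldimP/SS'/ldimP: E'; rewrite E.
Qed.

Section QuotientMap.
Variables (W : set V) (W' : set V') (f : {linear V -> V'}).
Hypothesis fW : forall x, W x -> lspan W' (f x).

(** The compatibility proof is carried as an argument, so that the linear structure declared below
    can be inferred from the term itself. *)
Definition quotl_map of (forall x, W x -> lspan W' (f x)) :=
  fun u : quotl W => piq W' (f (repr u)).

Lemma quotl_map_piq x : quotl_map fW (piq W x) = piq W' (f x).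
Proof.
apply/piq_eq; rewrite -linearB; apply: (lspan_image fW).
by apply/piq_eq; rewrite /piq reprK.
Qed.

Lemma quotl_map_is_linear : linear (quotl_map fW).
Proof.
move=> a u v; have [x ->] := piq_surj u; have [y ->] := piq_surj v.
by rewrite -linearP !quotl_map_piq !linearP.
Qed.
HB.instance Definition _ :=
  GRing.isLinear.Build F (quotl W) (quotl W') *:%R (quotl_map fW)
    quotl_map_is_linear.
End QuotientMap.
End LinearMaps.

(** * Reversal on paths and on the path algebra of the double quiver *)

Section PathReversal.
Variables (F : fieldType) (Q : quiver).
Local Notation DQ := (double_quiver Q).
Local Notation A := (path_alg F DQ).

Definition arr_star (a : arr DQ) : arr DQ :=
  match a with inl c => inr c | inr c => inl c end.

Lemma arr_starK : involutive arr_star. Proof. by case. Qed.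
Lemma asrc_star a : asrc (arr_star a) = atgt a. Proof. by case: a. Qed.
Lemma atgt_star a : atgt (arr_star a) = asrc a. Proof. by case: a. Qed.

(** The two claims need a joint induction: the reversal of [a :: s] appends the star of [a] to the
    reversal of [s], and this is a path only because the latter ends at the target of [a]. *)
Lemma rev_pathP (x : vtx DQ) (s : seq (arr DQ)) : is_path x s ->
  is_path (last x (map (@atgt DQ) s)) (rev (map arr_star s)) /\
  last (last x (map (@atgt DQ) s)) (map (@atgt DQ) (rev (map arr_star s))) = x.
Proof.
elim: s x => //= a s IHs x /andP[/eqP ax /IHs[ps ls]].
rewrite rev_cons -cats1 is_path_cat ps ls map_cat last_cat.
by split; case: a ax {IHs ps ls} => c /= ax; rewrite ?eqxx.
Qed.

Definition rev_path (p : qpath DQ) : qpath DQ :=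
  exist _ (ptgt p, rev (map arr_star (parr p))) (rev_pathP (valP p)).1.

Lemma ptgt_rev p : ptgt (rev_path p) = psrc p.
Proof. exact: (rev_pathP (valP p)).2. Qed.

Lemma plen_rev p : plen (rev_path p) = plen p.
Proof. by rewrite /plen size_rev size_map. Qed.

Lemma rev_pathK : involutive rev_path.
Proof.
move=> p; apply: qpathP; first exact: ptgt_rev.
rewrite /parr /= map_rev revK mapK //; exact: arr_starK.
Qed.

Fact palg_rev_key : unit. Proof. by []. Qed.
(* Locked, to keep unification from unfolding reversals. *)
Definition palg_rev : A -> A :=
  locked_with palg_rev_key (malg_lin (fun p => pelt F (rev_path p))).

Lemma palg_revE x : palg_rev x = malg_lin (fun p => pelt F (rev_path p)) x.
Proof. by rewrite /palg_rev locked_withE. Qed.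

Lemma palg_rev_is_linear : linear palg_rev.
Proof. by move=> a x y; rewrite !palg_revE linearP. Qed.
HB.instance Definition _ :=
  GRing.isLinear.Build F A A *:%R palg_rev palg_rev_is_linear.

Lemma palg_rev_pelt p : palg_rev (pelt F p) = pelt F (rev_path p).
Proof. by rewrite palg_revE; exact: malg_linU. Qed.

Lemma palg_rev_pmul_basis p q :
  palg_rev (pmul_basis F p q) = pmul_basis F (rev_path q) (rev_path p).
Proof.
rewrite /pmul_basis; have [pq|npq] := eqVneq (ptgt p) (psrc q).
  have [r [-> rs rt ra]] := pcatP pq.
  have qp : ptgt (rev_path q) = psrc (rev_path p) by rewrite ptgt_rev -pq.
  have [s [-> ss _ sa]] := pcatP qp.
  rewrite palg_rev_pelt; congr pelt; apply: qpathP.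
    exact: etrans rt (esym ss).
  by rewrite sa {1}/parr /= ra map_cat rev_cat.
(* If [p] does not end where [q] starts, the reversed paths do not compose either, and both sides
   are 0. *)
rewrite !pcatN ?linear0 //; last exact/eqP.
by rewrite ptgt_rev => /esym/eqP; rewrite (negPf npq).
Qed.

Lemma palg_revM x y : palg_rev (x * y) = palg_rev y * palg_rev x.
Proof.
rewrite [x * y]pmul_def (malg_lin_comp _ palg_rev).
(* Expanding the right factor first puts the sum over the paths of [x] outside on both sides; the
   sums then match term by term. *)
rewrite !palg_revE [RHS]pmul_linr.
apply: eq_malg_lin => p; rewrite /= (malg_lin_comp _ palg_rev) [RHS]pmul_linl.
by apply: eq_malg_lin => q; rewrite /= palg_rev_pmul_basis pmulE.
Qed.

Lemma palg_revK : involutive palg_rev.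
Proof.
move=> x; rewrite [X in palg_rev X]palg_revE (malg_lin_comp _ palg_rev).
rewrite -[RHS]malg_lin_id; apply: eq_malg_lin => p.
by rewrite /= palg_rev_pelt rev_pathK.
Qed.

Lemma palg_rev_arr a : palg_rev (arr_elt F a) = arr_elt F (arr_star a).
Proof.
rewrite palg_rev_pelt; congr pelt; apply: qpathP => //.
exact/esym/asrc_star.
Qed.

(** Since [arr_star] is an involution without signs, reversal fixes the product of any arrow with
    its star; taking [inl c] and [inr c] as the arrow covers both terms of each commutator. *)
Lemma palg_rev_rel : palg_rev (preproj_rel F Q) = preproj_rel F Q.
Proof.
(* Direct rewriting would compare distinct [arr_elt]s by unfolding them. *)
have fixB (u v : A) : palg_rev u = u -> palg_rev v = v ->
    palg_rev (u - v) = u - v.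
  by move=> fu fv; rewrite linearB /= fu fv.
have fixM a : palg_rev (arr_elt F a * arr_elt F (arr_star a)) =
    arr_elt F a * arr_elt F (arr_star a).
  apply: etrans (palg_revM _ _) (f_equal2 _ _ (palg_rev_arr a)).
  by rewrite palg_rev_arr arr_starK.
rewrite [LHS]linear_sum; apply: eq_bigr => c _ /=.
by apply: fixB; [exact: (fixM (inl c)) | exact: (fixM (inr c))].
Qed.

(** * Descent to the preprojective algebra and its corner *)

Lemma palg_rev_gens x :
  @preproj_gens F Q x -> lspan (@preproj_gens F Q) (palg_rev x).
Proof.
(* The outer factors trade places, and the middle one is fixed. *)
move=> [a [b ->]]; apply: sub_lspan; exists (palg_rev b), (palg_rev a).
by rewrite !palg_revM palg_rev_rel mulrA.
Qed.

Lemma pi_preproj_surj (u : preproj F Q) : exists x, u = pi_preproj x.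
Proof. exact: piq_surj. Qed.

Definition preproj_rev : preproj F Q -> preproj F Q := quotl_map palg_rev_gens.
HB.instance Definition _ := GRing.Linear.on preproj_rev.

Lemma preproj_rev_pi x : preproj_rev (pi_preproj x) = pi_preproj (palg_rev x).
Proof. exact: quotl_map_piq. Qed.

Lemma preproj_revK : involutive preproj_rev.
Proof.
move=> u; have [x ->] := pi_preproj_surj u.
by rewrite !preproj_rev_pi palg_revK.
Qed.

Lemma preproj_revM u v : preproj_rev (u * v) = preproj_rev v * preproj_rev u.
Proof.
have [x ->] := pi_preproj_surj u; have [y ->] := pi_preproj_surj v.
rewrite [_ * _ in LHS]ppmul_pi !preproj_rev_pi palg_revM.
exact/esym/ppmul_pi.
Qed.

(** Used with both outer factors [e_I] for the corner algebra, and with [e_i], [e_j] for the arrow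
    spaces. *)
Lemma preproj_rev_sandwich a u b :
  preproj_rev a = a -> preproj_rev b = b ->
  preproj_rev (a * u * b) = b * preproj_rev u * a.
Proof. by move=> fa fb; rewrite !preproj_revM fa fb mulrA. Qed.

Lemma preproj_rev_idem i : preproj_rev (vtx_idem F i) = vtx_idem F i.
Proof.
rewrite preproj_rev_pi palg_rev_pelt.
by congr (pi_preproj (pelt _ _)); apply: qpathP.
Qed.

Lemma preproj_rev_set_idem I : preproj_rev (set_idem F I) = set_idem F I.
Proof.
by rewrite linear_sum; apply: eq_bigr => i _; exact: preproj_rev_idem.
Qed.

Lemma preproj_rev_deg d u : preproj_deg d u -> preproj_deg d (preproj_rev u).
Proof.
apply: lspan_image => _ [p pd <-]; apply: sub_lspan.
by exists (rev_path p); rewrite /= ?plen_rev // preproj_rev_pi palg_rev_pelt.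
Qed.

Lemma preproj_rev_corner_pos I u :
  corner_pos I u -> corner_pos I (preproj_rev u).
Proof.
apply: lspan_image => _ [[x _ <-] [d d0 xd]]; apply: sub_lspan; split.
  exists (preproj_rev x) => //.
  by apply/esym/preproj_rev_sandwich; exact: preproj_rev_set_idem.
by exists d => //; exact: preproj_rev_deg.
Qed.

Lemma preproj_rev_corner_pos2 I u :
  corner_pos2 I u -> corner_pos2 I (preproj_rev u).
Proof.
apply: lspan_image => _ [x xI [y yI <-]]; apply: sub_lspan.
exists (preproj_rev y); first exact: preproj_rev_corner_pos.
exists (preproj_rev x); first exact: preproj_rev_corner_pos.
by rewrite /= preproj_revM.
Qed.

(** * The induced involution of the quotient by [J^2] *)

Section CornerQuotient.
Variable I : {set vtx Q}.

Lemma preproj_rev_corner_pos2_lspan u :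
  @corner_pos2 F Q I u -> lspan (@corner_pos2 F Q I) (preproj_rev u).
Proof. by move=> uI; apply/sub_lspan/preproj_rev_corner_pos2. Qed.

Definition corner_rev := quotl_map preproj_rev_corner_pos2_lspan.
HB.instance Definition _ := GRing.Linear.on corner_rev.

Lemma corner_rev_piq u :
  corner_rev (piq _ u) = piq (corner_pos2 I) (preproj_rev u).
Proof. exact: quotl_map_piq. Qed.

Lemma corner_revK : involutive corner_rev.
Proof.
by move=> v; have [u ->] := piq_surj v; rewrite !corner_rev_piq preproj_revK.
Qed.

Lemma corner_rev_arrows i j :
  corner_rev @` corner_arrows i j = corner_arrows j i.
Proof.
have revE u k l : corner_rev (piq _ (vtx_idem F k * u * vtx_idem F l)) =
    piq (corner_pos2 I) (vtx_idem F l * preproj_rev u * vtx_idem F k).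
  rewrite corner_rev_piq; congr piq.
  by apply: preproj_rev_sandwich; exact: preproj_rev_idem.
apply/seteqP; split=> [_ [_ [u uI <-] <-]|_ [u uI <-]].
  by exists (preproj_rev u); [exact: preproj_rev_corner_pos | rewrite revE].
(* As reversal is an involution, the preimage is the reversal of the given element. *)
exists (piq _ (vtx_idem F i * preproj_rev u * vtx_idem F j)).
  by exists (preproj_rev u) => //; exact: preproj_rev_corner_pos.
by rewrite revE preproj_revK.
Qed.

(** The injective map [corner_rev] carries a basis of either arrow space to a basis of the other. *)
Lemma arrow_count_sym i j : arrow_count F I i j = arrow_count F I j i.
Proof.
apply: eq_ldim => n; split=> Sn; rewrite -corner_rev_arrows;
  exact: (has_dim_image (inv_inj corner_revK)).
Qed.
End CornerQuotient.
End PathReversal.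

Theorem theorem5p2p1 (R : realType) (t : affine_type)
    (o : orientation (aff_diagram t)) (I : {set 'I_(aff_rank t).+1})
    (I0 : ord0 \in I) (i j : 'I_(aff_rank t).+1)
    (iI : i \in I) (jI : j \in I) :
  @arrow_count (complex R) (orient o) I i j
  = @arrow_count (complex R) (orient o) I j i.
Proof. exact: arrow_count_sym. Qed.
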